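(* Let $X$ be an ordered Banach space whose positive cone $X_+$ is norm-closed and generating (i.e. $X = X_+ - X_+$). Let $\mathcal{S}$ be a family of semi-norms on $X$ that is equi-bounded on order intervals, i.e. for all $a,b\in X$ the set $\{s(x) : s\in\mathcal{S},\ x\in[a,b]\}$ is bounded in $\mathbb{R}$. Then $\mathcal{S}$ is equi-continuous, i.e. the set $\{s(x) : s\in\mathcal{S},\ x\in B_X\}$ is bounded in $\mathbb{R}$.
   Context: All vector spaces are real. An ordered Banach space is a Banach space $X$ that is also an ordered vector space, with positive cone $X_+=\{x\in X: x\ge 0\}$ (a convex cone with $X_+\cap(-X_+)=\{0\}$, and $x\le y$ iff $y-x\in X_+$); no compatibility between norm and order is assumed beyond what is stated. The order interval is $[a,b]=\{x\in X: a\le x\le b\}$. $B_X$ denotes the closed unit ball of $X$. The semi-norms in $\mathcal{S}$ are not assumed to be continuous. A family $\mathcal{S}$ of semi-norms on a vector space $X$ is equi-bounded on a subset $A\subseteq X$ if $\mathcal{S}A=\{s(x): s\in\mathcal{S}, x\in A\}$ is bounded in $\mathbb{R}$; a family of semi-norms on a normed space $X$ is equi-continuous iff it is equi-bounded on $B_X$. *)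

(* Defs.v *)
From HB Require Import structures.
From mathcomp Require Import all_boot all_order all_algebra.
From mathcomp Require Import all_classical all_reals all_analysis.

Set Implicit Arguments.
Unset Strict Implicit.
Unset Printing Implicit Defensive.

Import Order.TTheory GRing.Theory Num.Theory.
Import numFieldNormedType.Exports.

Local Open Scope classical_set_scope.
Local Open Scope ring_scope.

(* The order is a new operation [lev] rather than an [Order.POrder] structure:
   [Num.NumDomain] already inherits from both [Order.POrder] and the normed
   structures, so Hierarchy Builder does not accept a later structure that joins
   [Order.POrder] and [CompleteNormedModule]. *)
HB.mixin Record Lmodule_isOrdered (R : numDomainType) X of GRing.Lmodule R X := {
  lev : rel X ;
  lev_refl : reflexive lev ;
  lev_anti : antisymmetric lev ;
  lev_trans : transitive lev ;
  levD2r : forall z x y : X, lev x y -> lev (x + z) (y + z) ;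
  levZ2l : forall (a : R) (x y : X), 0 <= a -> lev x y -> lev (a *: x) (a *: y)
}.

#[short(type="orderedLmodType")]
HB.structure Definition OrderedLmodule (R : numDomainType) :=
  { X of GRing.Lmodule R X & Lmodule_isOrdered R X }.

#[short(type="orderedBanachType")]
HB.structure Definition OrderedBanach (R : numFieldType) :=
  { X of CompleteNormedModule R X & OrderedLmodule R X }.

Section ordered_lmodule.
Context {R : numDomainType} {X : orderedLmodType R}.
Implicit Types a b x y : X.

Definition positive_cone : set X := [set x | lev 0 x].

Definition order_interval a b : set X := [set x | lev a x && lev x b].

Definition generating_cone : Prop :=
  [set x - y | x in positive_cone & y in positive_cone] = setT.

Lemma lev_subr x y : lev x y <-> positive_cone (y - x).
Proof.
rewrite /positive_cone /=; split=> [/(levD2r (- x))|/(levD2r x)].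
- by rewrite subrr.
- by rewrite add0r subrK.
Qed.

End ordered_lmodule.

Arguments positive_cone {R} X.
Arguments generating_cone {R} X.

Definition semi_norm {R : numDomainType} {X : lmodType R} (s : X -> R) : Prop :=
  [/\ forall x, 0 <= s x,
      forall (a : R) x, s (a *: x) = `|a| * s x
    & forall x y, s (x + y) <= s x + s y].

Definition equi_bounded {R : realType} {X : Type}
    (S : set (X -> R)) (A : set X) : Prop :=
  bounded_set [set s x | s in S & x in A].

(* Main.v *)
Require Import Defs.
From mathcomp Require Import all_boot all_order all_algebra.
From mathcomp Require Import all_classical all_reals all_analysis.

Set Implicit Arguments.
Unset Strict Implicit.
Unset Printing Implicit Defensive.

Import Order.TTheory GRing.Theory Num.Theory.
Import numFieldNormedType.Exports.
Local Open Scope classical_set_scope.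
Local Open Scope ring_scope.

(** On the cone, equi-boundedness on order intervals already forces a linear
bound [s x <= C * `|x|], uniform in [s]. Otherwise one finds positive [u_k] in
the unit ball and semi-norms [s_k] of the family with [s_k u_k > k 2^k]; as the
cone is closed, [y = \sum_k 2^-k u_k] dominates every [2^-k u_k], so all these
terms lie in the single interval [0, y], although [s_k (2^-k u_k) > k].
This is [semi_norms_bounded_on_cone].

What remains is to write each [x] as a difference of two positive elements of
norm at most [M * `|x|], with [M] independent of [x]; this is
[bounded_decomposition], a form of the open mapping theorem for the map
(y, z) |-> y - z on the cone. The space is the union of the sets [D_n] of
differences of positive elements of norm at most [n], so by Baire the closure
of some [D_n] contains a ball. Subtracting approximations of two points of this
ball and rescaling gives, for each [h], a controlled difference within
[`|h| / 2] of [h]. Iterating on the error and summing the corrections, which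
again requires a closed cone, turns the approximation into an equality.

Together the two bounds give [s x <= K * `|x|] uniformly in [s]. The semi-norms
are therefore bounded on the unit ball, and all [K]-Lipschitz by the reverse
triangle inequality, hence equicontinuous at every point. *)

(** * The positive cone, bounded families and semi-norms *)

Section OrderedLmodule.
Context {R : numDomainType} {X : orderedLmodType R}.

Lemma positive_cone0 : positive_cone X 0.
Proof. exact: lev_refl. Qed.

Lemma positive_coneD (x y : X) :
  positive_cone X x -> positive_cone X y -> positive_cone X (x + y).
Proof.
move=> x0 y0; apply: lev_trans y0 _.
by have := levD2r y _ _ x0; rewrite add0r.
Qed.

Lemma positive_coneZ (a : R) (x : X) :
  0 <= a -> positive_cone X x -> positive_cone X (a *: x).
Proof. by move=> a0 x0; have := levZ2l _ _ _ a0 x0; rewrite scaler0. Qed.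

Lemma positive_cone_sum (I : Type) (r : seq I) (P : pred I) (u : I -> X) :
  (forall i, P i -> positive_cone X (u i)) ->
  positive_cone X (\sum_(i <- r | P i) u i).
Proof.
move=> u0; apply: big_ind => //; first exact: positive_cone0.
exact: positive_coneD.
Qed.

End OrderedLmodule.

Section EquiBounded.
Context {R : realType} {X : Type}.

Lemma equi_boundedP (S : set (X -> R)) (A : set X) :
  equi_bounded S A <->
  exists M, forall s x, S s -> A x -> `|s x| <= M.
Proof.
rewrite /equi_bounded /=; split=> [/ex_strict_bound_gt0[M _ HM]|[M HM]].
  by exists M => s x Ss Ax; apply/ltW/HM; exists s => //; exists x.
exists M; split; first exact: num_real.
by move=> N /ltW MN _ [s Ss [x Ax <-]]; apply: le_trans MN; exact: HM.
Qed.

End EquiBounded.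

Section SemiNorm.
Context {R : numDomainType} {X : lmodType R} (s : X -> R) (sn : semi_norm s).

Lemma semi_normB (x y : X) : s (x - y) <= s x + s y.
Proof.
case: sn => _ sZ sD; apply: le_trans (sD _ _) _.
by rewrite -scaleN1r sZ normrN1 mul1r.
Qed.

End SemiNorm.

Lemma semi_norm_dist {R : realDomainType} {X : lmodType R} (s : X -> R)
  (x y : X) : semi_norm s -> `|s x - s y| <= s (x - y).
Proof.
move=> sn; have [_ sZ sD] := sn.
have sym : s (y - x) = s (x - y).
  by rewrite -(opprB x y) -(scaleN1r (x - y)) sZ normrN1 mul1r.
rewrite ler_norml lerBlDr lerNl opprB lerBlDr -{1}sym.
have := sD (y - x) x; have := sD (x - y) y; rewrite !subrK => -> ->.
by [].
Qed.

(** * Bounded decomposition into positive parts *)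

Section OrderedBanach.
Context {R : realType} {X : orderedBanachType R}.
Hypothesis closed_cone : closed (positive_cone X).

(** Removing one term from a series of positive elements leaves a limit of
finite sums of positive elements, so when the cone is closed the sum dominates
each of its terms. The geometric bound makes the series converge absolutely. *)
Lemma cone_geometric_series (c : R) (u : X^nat) :
    (forall k, positive_cone X (u k)) ->
    (forall k, `|u k| <= geometric c 2^-1 k) ->
  exists y, [/\ series u @ \oo --> y, `|y| <= c *+ 2 &
    forall k, positive_cone X (y - u k)].
Proof.
move=> u0 uc.
have half1 : `|2^-1 : R| < 1 by rewrite gtr0_norm ?invr_gt0// invf_lt1// ltr1n.
have ncvg : cvgn [normed series u].
  apply: (series_le_cvg _ _ uc) => // [k|]; first exact: le_trans (uc k).
  exact: is_cvg_geometric_series.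
have ucvg : cvgn (series u) := normed_cvg ncvg.
exists (limn (series u)); split => //.
  apply: le_trans (lim_series_norm ncvg) _.
  apply: le_trans (lim_series_le ncvg _ uc) _.
    exact: is_cvg_geometric_series.
  rewrite (cvg_lim _ (cvg_geometric_series half1)) //.
  have -> : 1 - 2^-1 = 2^-1 :> R by rewrite {1}(splitr 1) mul1r addrK.
  by rewrite invrK mulr_natr.
move=> k.
have cvgBu : series u n - u k @[n --> \oo] --> limn (series u) - u k.
  by apply: cvgB => //; exact: cvg_cst.
apply: (closed_cvg _ closed_cone _ _ cvgBu).
(* From rank k + 1 on, the partial sums contain the k-th term. *)
exists k.+1 => // n /= kn.
rewrite /series/= big_mkord (bigD1 (Ordinal kn))//= addrAC subrr add0r.
by apply: positive_cone_sum => i _; exact: u0.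
Qed.

Hypothesis gen_cone : generating_cone X.

Definition bounded_differences (M : R) : set X :=
  [set d | exists y z, [/\ positive_cone X y, positive_cone X z,
    `|y| <= M, `|z| <= M & d = y - z]].

Lemma bounded_differencesB (M : R) (d e : X) :
  bounded_differences M d -> bounded_differences M e ->
  bounded_differences (M *+ 2) (d - e).
Proof.
move=> [y [z [y0 z0 yM zM ->]]] [y' [z' [y0' z0' yM' zM' ->]]].
exists (y + z'), (z + y'); split; try exact: positive_coneD.
- by rewrite mulr2n (le_trans (ler_normD _ _))// lerD.
- by rewrite mulr2n (le_trans (ler_normD _ _))// lerD.
- by rewrite opprB opprD addrACA.
Qed.

Lemma bounded_differencesZ (a M : R) (d : X) : 0 <= a ->
  bounded_differences M d -> bounded_differences (a * M) (a *: d).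
Proof.
move=> a0 [y [z [y0 z0 yM zM ->]]].
exists (a *: y), (a *: z); rewrite !normrZ ger0_norm// scalerBr.
by split=> //; [exact: positive_coneZ|exact: positive_coneZ|
  exact: ler_wpM2l|exact: ler_wpM2l].
Qed.

(** Baire: since the cone is generating, the closed sets [closure D_n] cover the
space, so their complements cannot all be dense. *)
Lemma bounded_differences_somewhere_dense :
  exists (n : nat) (a : X) (r : R), 0 < r /\
    ball a r `<=` closure (bounded_differences n%:R).
Proof.
pose F n := ~` closure (bounded_differences n%:R).
have [n Fn] : exists n, ~ dense (F n).
  apply: contrapT => /forallNP Fdense.
  have /Baire : forall n, open (F n) /\ dense (F n).
    by move=> n; split; [exact/closed_openC/closed_closure|
      exact: contrapT (Fdense n)].
  case/(_ setT) => [||x [_ Fx]]; [by exists 0|exact: openT|].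
  have : [set x - y | x in positive_cone X & y in positive_cone X] x.
    by rewrite gen_cone.
  move=> [y y0 [z z0 xE]].
  have [N N_ge] : exists N : nat, Num.max `|y| `|z| <= N%:R.
    by exists (Num.truncn (Num.max `|y| `|z|)).+1; rewrite ltW// truncnS_gt.
  apply: (Fx N I); apply: subset_closure; exists y, z.
  by move: N_ge; rewrite ge_max => /andP[].
(* A nonempty open set that misses the complement of closure D_n. *)
move: Fn => /existsNP[U /not_implyP[[a Ua] /not_implyP[Uo UF]]].
have /nbhs_ballP[r r0 rU] : nbhs a U by exact: open_nbhs_nbhs.
exists n, a, r; split=> // x /rU Ux; apply: contrapT => Fx.
by apply: UF; exists x.
Qed.

(** For a suitable scalar [b], the multiple [b *: h] of [h] is the difference of
the points [b *: h + a] and [a] of the ball where [D_n] is dense; approximating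
both and subtracting moves the density from [a] to the origin. Rescaling by
[b^-1] makes the bounds proportional to [`|h|]; the factor 1/2 is what makes the
iteration in [bounded_decomposition] converge geometrically. *)
Lemma bounded_differences_approx :
  exists2 M : R, 0 <= M & forall h : X, exists y z : X,
    [/\ positive_cone X y, positive_cone X z,
      `|y| <= M * `|h|, `|z| <= M * `|h| & `|h - (y - z)| <= 2^-1 * `|h|].
Proof.
have [n [a [r [r0 rD]]]] := bounded_differences_somewhere_dense.
have approx x e : 0 < e -> ball a r x ->
    exists2 d, bounded_differences n%:R d & `|x - d| < e.
  move=> e0 /rD /(_ (ball x e) (nbhsx_ballx _ _ e0)) [d [Dd]].
  by rewrite -ball_normE /=; exists d.
(* A radius below r: the vector b *: h chosen below has norm exactly t. *)
pose t : R := 2^-1 * r.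
have t0 : 0 < t by rewrite mulr_gt0// invr_gt0.
have tr : t < r by rewrite /t gtr_pMl// invf_lt1// ltr1n.
exists (t^-1 * n%:R *+ 2) => [|h].
  by rewrite mulrn_wge0// mulr_ge0// invr_ge0 ltW.
have [->|h0] := eqVneq h 0.
  exists 0, 0; rewrite !normr0 !mulr0 !subr0 normr0.
  by split=> //; exact: positive_cone0.
have hp : 0 < `|h| by rewrite normr_gt0.
pose b := t / `|h|.
have b0 : 0 < b by rewrite divr_gt0.
(* Two errors below t / 4 add up to at most t / 2 = b * (`|h| / 2). *)
have e0 : 0 < 2^-1 * (2^-1 * t) by rewrite !mulr_gt0// invr_gt0.
have [|d Dd dE] := approx (b *: h + a) _ e0.
  rewrite -ball_normE /= opprD addrCA subrr addr0 normrN normrZ gtr0_norm//.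
  by rewrite /b mulfVK// gt_eqF.
have [|d' Dd' dE'] := approx a _ e0; first exact: ballxx.
have [y [z [y0 z0 yM zM dyz]]] : bounded_differences
    (b^-1 * (n%:R *+ 2)) (b^-1 *: (d - d')).
  by apply: bounded_differencesZ (bounded_differencesB Dd Dd');
    rewrite invr_ge0 ltW.
have bE : b^-1 * (n%:R *+ 2) = t^-1 * n%:R *+ 2 * `|h|.
  by rewrite /b invf_div mulrnAr -mulrA mulrnAl mulrC.
exists y, z; rewrite -bE; split=> //.
rewrite -dyz.
have -> : h - b^-1 *: (d - d') = b^-1 *: ((b *: h + a - d) - (a - d')).
  rewrite opprB addrA addrAC (addrAC _ (- d)) addrK -addrA (addrC (- d)).
  by rewrite -(opprB d d') [RHS]scalerBr scalerA mulVf ?scale1r// gt_eqF.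
rewrite normrZ gtr0_norm ?invr_gt0// ler_pdivrMl//.
have -> : b * (2^-1 * `|h|) = 2^-1 * (2^-1 * t) + 2^-1 * (2^-1 * t).
  by rewrite (mulrC 2^-1 (2^-1 * t)) -splitr mulrCA mulfVK// gt_eqF.
apply: le_trans (ler_normB _ _) _.
by apply: lerD; exact: ltW.
Qed.

(** Approximating [x], then the error, then the error of the error, and so on:
the errors [rho k] decrease like [`|x| / 2^k], so the positive parts used at
each stage form geometric series, whose sums are the parts of [x]. *)
Lemma bounded_decomposition :
  exists2 M : R, 0 <= M & forall x : X, exists y z : X,
    [/\ positive_cone X y, positive_cone X z,
      `|y| <= M * `|x|, `|z| <= M * `|x| & x = y - z].
Proof.
have [M M0 approx] := bounded_differences_approx.
exists (M *+ 2) => [|x]; first exact: mulrn_wge0.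
have [f /choice[g fg]] := choice approx.
pose rho k := iter k (fun h => h - (f h - g h)) x.
have rhoS k : rho k.+1 = rho k - (f (rho k) - g (rho k)) by [].
have rho_le k : `|rho k| <= geometric `|x| 2^-1 k.
  rewrite /geometric/=; elim: k => [|k IH]; first by rewrite expr0 mulr1.
  rewrite rhoS; have [_ _ _ _ /le_trans->//] := fg (rho k).
  by rewrite exprS mulrCA ler_wpM2l// invr_ge0.
have geoM k : M * `|rho k| <= geometric (M * `|x|) 2^-1 k.
  by rewrite /geometric/= -mulrA ler_wpM2l.
have [|k|y [ycvg yM y0]] := @cone_geometric_series (M * `|x|) (f \o rho).
- by move=> k; have [] := fg (rho k).
- by apply: le_trans (geoM k); have [] := fg (rho k).
have [|k|z [zcvg zM z0]] := @cone_geometric_series (M * `|x|) (g \o rho).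
- by move=> k; have [] := fg (rho k).
- by apply: le_trans (geoM k); have [] := fg (rho k).
exists y, z; rewrite !mulrnAl; split=> //.
- rewrite -(subrK (f (rho 0)) y); apply: positive_coneD; first exact: (y0 0%N).
  by have [] := fg (rho 0).
- rewrite -(subrK (g (rho 0)) z); apply: positive_coneD; first exact: (z0 0%N).
  by have [] := fg (rho 0).
(* Each stage subtracts its correction from the error: the sum telescopes. *)
have sumE : series (f \o rho) \- series (g \o rho) = (fun n => x - rho n).
  apply/funext => n; rewrite /series/= -sumrB.
  elim: n => [|n IH]; first by rewrite big_geq// subrr.
  by rewrite big_nat_recr// rhoS IH (opprB (rho n)) addrA addrAC.
have rho0 : rho k @[k --> \oo] --> (0 : X).
  apply/norm_cvg0P; apply: squeeze_cvgr (cvg_cst 0) (cvg_geometric `|x| _).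
    by near=> k; apply/andP; split; [exact: normr_ge0|exact: rho_le].
  by rewrite gtr0_norm ?invr_gt0// invf_lt1// ltr1n.
have cvg_x : x - rho k @[k --> \oo] --> x - 0.
  by apply: cvgB => //; exact: cvg_cst.
have cvg_yz : x - rho k @[k --> \oo] --> y - z by rewrite -sumE; exact: cvgB.
by rewrite -[LHS]subr0; exact: (cvg_unique (@norm_hausdorff _ X) cvg_x cvg_yz).
Unshelve. all: by end_near.
Qed.

(** * The uniform bound on the semi-norms *)

Context (S : set (X -> R)).
Hypothesis S_semi_norm : forall s, S s -> semi_norm s.
Hypothesis S_itv : forall a b : X, equi_bounded S (order_interval a b).

(** By homogeneity it is enough to bound the family on the positive part of the
unit ball. A lower bound [k 2^k] in the negation leaves [k] after the rescaling
by [2^-k] that puts all the terms in one order interval. *)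
Lemma semi_norms_bounded_on_cone :
  exists2 C : R, 0 <= C &
    forall s x, S s -> positive_cone X x -> s x <= C * `|x|.
Proof.
suff [C HC] : exists C : R, forall s x, S s -> positive_cone X x -> `|x| <= 1 ->
    s x <= C.
  exists `|C| => // s x Ss x0; have [_ sZ _] := S_semi_norm Ss.
  have [->|xn0] := eqVneq x 0.
    by rewrite normr0 mulr0 -(scale0r (0 : X)) sZ normr0 mul0r.
  have xp : 0 < `|x| by rewrite normr_gt0.
  rewrite -ler_pdivrMr// mulrC -(gtr0_norm xp) -normfV -sZ.
  apply: le_trans (ler_norm C); apply: HC => //.
    by apply: positive_coneZ => //; rewrite invr_ge0.
  by rewrite normrZ normfV normr_id mulVf// gt_eqF.
apply: contrapT => /forallNP unb.
have /choice[s /choice[u su]] : forall k : nat, exists s (x : X),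
    [/\ S s, positive_cone X x, `|x| <= 1 & k%:R * 2 ^+ k < s x].
  move=> k; have /existsNP[s /existsNP[x /not_implyP[Ss /not_implyP[x0
    /not_implyP[x1 /negP]]]]] := unb (k%:R * 2 ^+ k).
  by rewrite -ltNge => lt; exists s, x.
pose v k := 2^-1 ^+ k *: u k.
have v0 k : positive_cone X (v k).
  by have [_ u0 _ _] := su k; exact: positive_coneZ.
have [k|y [_ _ yv]] := @cone_geometric_series 1 v v0.
  have [_ _ u1 _] := su k.
  rewrite normrZ ger0_norm ?exprn_ge0 ?invr_ge0// /geometric/= mul1r.
  by rewrite ler_piMr// exprn_ge0// invr_ge0.
have /equi_boundedP[B HB] := S_itv 0 y.
have [k Bk] : exists k : nat, B < k%:R.
  by exists (Num.truncn B).+1; exact: truncnS_gt.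
have [Ss _ _ big] := su k; have [_ sZ _] := S_semi_norm Ss.
have : `|s k (v k)| <= B.
  by apply: HB => //; apply/andP; split; [exact: v0|exact/lev_subr/yv].
apply/negP; rewrite -ltNge; apply: lt_trans Bk _.
apply: lt_le_trans (ler_norm _).
rewrite sZ ger0_norm ?exprn_ge0 ?invr_ge0// exprVn ltr_pdivlMl ?exprn_gt0//.
by rewrite mulrC.
Qed.

Lemma semi_norms_bounded :
  exists2 K : R, 0 <= K & forall s x, S s -> s x <= K * `|x|.
Proof.
have [M M0 dec] := bounded_decomposition.
have [C C0 HC] := semi_norms_bounded_on_cone.
exists (C * M *+ 2) => [|s x Ss]; first by rewrite mulrn_wge0// mulr_ge0.
have [y [z [y0 z0 yM zM xE]]] := dec x.
rewrite {1}xE; apply: le_trans (semi_normB (S_semi_norm Ss) _ _) _.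
rewrite mulrnAl mulr2n -mulrA; apply: lerD.
  by apply: le_trans (HC _ _ Ss y0) _; rewrite ler_wpM2l.
by apply: le_trans (HC _ _ Ss z0) _; rewrite ler_wpM2l.
Qed.

End OrderedBanach.

Theorem theorem1 (R : realType) (X : orderedBanachType R) (S : set (X -> R))
    (closed_cone : closed (positive_cone X))
    (gen_cone : generating_cone X)
    (S_semi_norm : forall s, S s -> semi_norm s)
    (S_itv : forall a b : X, equi_bounded S (order_interval a b)) :
  equicontinuous S id /\ equi_bounded S (closed_ball (0 : X) 1).
Proof.
have [K K0 HK] := semi_norms_bounded closed_cone gen_cone S_semi_norm S_itv.
split=> [x E /= |].
  rewrite -entourage_ballE => -[e /= e0 eE].
  (* K + 1 rather than K, since K may vanish. *)
  have d0 : 0 < e / (K + 1) by rewrite divr_gt0// ltr_wpDl.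
  apply/nbhs_ballP; exists (e / (K + 1)) => //= y.
  rewrite -ball_normE /= => xy s Ss; apply: eE => /=.
  rewrite -ball_normE /=.
  apply: (le_lt_trans (semi_norm_dist x y (S_semi_norm _ Ss))).
  apply: le_lt_trans (HK _ _ Ss) _.
  apply: (@le_lt_trans _ _ ((K + 1) * `|x - y|)).
    by rewrite ler_wpM2r// lerDl.
  by rewrite mulrC -ltr_pdivlMr// ltr_wpDl.
apply/equi_boundedP; exists K => s x Ss.
rewrite closed_ballE// /closed_ball_ /= sub0r normrN => x1.
have [s0 _ _] := S_semi_norm _ Ss; rewrite ger0_norm//.
by apply: le_trans (HK _ _ Ss) _; rewrite ler_piMr.
Qed.
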